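(* Let $\Omega$ be a countably infinite set and let $Q\in[0,1]^{\Omega\times\Omega}$ be column-stochastic, i.e. $\sum_{i\in\Omega}Q^{(i,j)}=1$ for all $j\in\Omega$. Then the mean ergodic subspace of $Q$ in $\ell^1(\Omega)$ is the direct sum of the kernel of $\mathrm{Id}-Q$ and the closure of the image of $\mathrm{Id}-Q$: $$\ell^1_{\mathrm{m.e.}}(\Omega,Q)=\ker(\mathrm{Id}-Q)\oplus\overline{\mathrm{image}(\mathrm{Id}-Q)}.$$
   Context: $\ell^1(\Omega)$ is the space of real absolutely summable families with norm $\|X\|_1=\sum_{\omega\in\Omega}|X^{(\omega)}|$. $Q$ acts on $\ell^1(\Omega)$ by $(QX)^{(i)}=\sum_{j\in\Omega}Q^{(i,j)}X^{(j)}$; kernel and image of $\mathrm{Id}-Q$ are taken in $\ell^1(\Omega)$ and the closure is with respect to $\|\cdot\|_1$. For $M\in\mathbb N$, $M\geq 1$, $\mathcal C_M(X)=\frac1M\sum_{i=0}^{M-1}Q^iX$, and $$\ell^1_{\mathrm{m.e.}}(\Omega,Q)=\{X\in\ell^1(\Omega):\lim_{M\to\infty}\mathcal C_M(X)\text{ exists with respect to }\|\cdot\|_1\}.$$ *)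

(* Defs.v *)
From HB Require Import structures.
From mathcomp Require Import all_boot all_order all_algebra.
From mathcomp Require Import all_classical all_reals all_analysis.
Import Order.TTheory GRing.Theory Num.Theory numFieldNormedType.Exports.

Set Implicit Arguments.
Unset Strict Implicit.
Unset Printing Implicit Defensive.

Local Open Scope classical_set_scope.
Local Open Scope ring_scope.

Lemma ge0_esumZl (R : realType) (T : choiceType) (D : set T) (r : R)
    (f : T -> \bar R) : 0 <= r -> (forall i, 0 <= f i)%E ->
  (\esum_(i in D) (r%:E * f i) = r%:E * \esum_(i in D) f i)%E.
Proof.
move=> r0 f0; rewrite /esum -ereal_supZl//; last first.
  by apply/set0P; exists (\sum_(i \in set0) f i)%E; exists set0 => //; exact: fsets_set0.
congr ereal_sup; apply/seteqP; split => [_ [A DA <-]|_ [_ [A DA <-] <-]].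
- by exists (\sum_(i \in A) f i)%E; [exists A|rewrite ge0_mule_fsumr].
- by exists A => //; rewrite ge0_mule_fsumr.
Qed.

Lemma exchange_esumT (R : realType) (T : choiceType) (a : T -> T -> \bar R) :
  (forall i j, 0 <= a i j)%E ->
  (\esum_(i in [set: T]) \esum_(j in [set: T]) a i j =
   \esum_(j in [set: T]) \esum_(i in [set: T]) a i j)%E.
Proof.
move=> a0; rewrite !esum_esum//.
rewrite (reindex_esum ([set: T] `*`` (fun=> [set: T])) _
  (fun x => (x.2, x.1)))//; split=> //=.
- by move=> [i1 i2] [j1 j2] /= _ _ [] -> ->.
- by move=> [i1 i2] _ /=; exists (i2, i1).
Qed.

Definition ell1_pred {R : realType} {Omega : choiceType} : {pred Omega -> R} :=
  fun X => summable [set: Omega] (EFin \o X).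

Section Ell1_closed.
Context {R : realType} {Omega : choiceType}.
Implicit Types X Y : Omega -> R.

Lemma ell1_predE X :
  (X \in ell1_pred) = (\esum_(w in [set: Omega]) `|X w|%:E < +oo)%E.
Proof. by []. Qed.

Lemma ell1_submod : submod_closed (@ell1_pred R Omega).
Proof.
split => [|a X Y].
  by rewrite ell1_predE esum1 ?ltry// => w _; rewrite normr0.
rewrite !ell1_predE => sX sY.
apply: (@le_lt_trans _ _
    (\esum_(w in [set: Omega]) (`|a * X w|%:E + `|Y w|%:E))%E).
  apply: le_esum => w _; rewrite -EFinD lee_fin; exact: ler_normD.
rewrite esumD//; apply: lte_add_pinfty => //.
under eq_esum do rewrite normrM EFinM.
by rewrite ge0_esumZl// lte_mul_pinfty.
Qed.

End Ell1_closed.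

HB.instance Definition _ (R : realType) (Omega : choiceType) :=
  GRing.isSubmodClosed.Build R _ ell1_pred (@ell1_submod R Omega).

Record ell1 (R : realType) (Omega : choiceType) := Ell1 {
  ell1_fun :> Omega -> R ;
  ell1_prop : ell1_fun \in ell1_pred }.

HB.instance Definition _ (R : realType) (Omega : choiceType) :=
  [isSub for @ell1_fun R Omega].
HB.instance Definition _ (R : realType) (Omega : choiceType) :=
  [Choice of ell1 R Omega by <:].
HB.instance Definition _ (R : realType) (Omega : choiceType) :=
  [SubChoice_isSubLmodule of ell1 R Omega by <:].

Section Ell1_norm.
Context {R : realType} {Omega : choiceType}.
Implicit Types X Y : ell1 R Omega.

Definition ell1_norm X : R := fine (\esum_(w in [set: Omega]) `|X w|%:E)%E.

Lemma ell1_normK X :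
  (ell1_norm X)%:E = (\esum_(w in [set: Omega]) `|X w|%:E)%E.
Proof.
rewrite fineK// ge0_fin_numE; last by apply: esum_ge0 => w _; rewrite lee_fin.
exact: ell1_prop.
Qed.

Lemma ell1_normD X Y : ell1_norm (X + Y) <= ell1_norm X + ell1_norm Y.
Proof.
rewrite -lee_fin EFinD !ell1_normK -esumD//.
by apply: le_esum => w _; rewrite -EFinD lee_fin; exact: ler_normD.
Qed.

Lemma ell1_normZ (a : R) X : ell1_norm (a *: X) = `|a| * ell1_norm X.
Proof.
apply: EFin_inj; rewrite EFinM !ell1_normK -ge0_esumZl//.
by apply: eq_esum => w _; rewrite -EFinM -normrM.
Qed.

Lemma ell1_norm0_eq0 X : ell1_norm X = 0 -> X = 0.
Proof.
move=> X0; apply/val_inj/funext => w /=; apply/eqP.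
rewrite -normr_le0 -lee_fin -X0 ell1_normK.
rewrite -(@esum_set1 _ _ w (fun w => `|X w|%:E))//.
rewrite esum_mkcond; apply: le_esum => v _.
by case: ifP => // _; rewrite lee_fin.
Qed.

HB.instance Definition _ := Lmodule_isNormed.Build R (ell1 R Omega)
  ell1_normD ell1_normZ ell1_norm0_eq0.

Lemma ell1_normE X : `|X| = ell1_norm X. Proof. by []. Qed.

End Ell1_norm.

(* Unordered sum of a summable real family, as the difference of the sums of
   its positive and negative parts *)
Definition rsum {R : realType} {Omega : choiceType} (f : Omega -> R) : R :=
  fine (\esum_(w in [set: Omega]) (f^\+ w)%:E)%E -
  fine (\esum_(w in [set: Omega]) (f^\- w)%:E)%E.

Lemma le_norm_rsum {R : realType} {Omega : choiceType} (f : Omega -> R) :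
  (`|rsum f|%:E <= \esum_(w in [set: Omega]) `|f w|%:E)%E.
Proof.
set p := (\esum_(w in [set: Omega]) (f^\+ w)%:E)%E.
set n := (\esum_(w in [set: Omega]) (f^\- w)%:E)%E.
have p0 : (0 <= p)%E by apply: esum_ge0 => w _; rewrite lee_fin funrpos_ge0.
have n0 : (0 <= n)%E by apply: esum_ge0 => w _; rewrite lee_fin funrneg_ge0.
have -> : (\esum_(w in [set: Omega]) `|f w|%:E = p + n)%E.
  rewrite -esumD; last 2 first.
  - by move=> w _; rewrite lee_fin funrpos_ge0.
  - by move=> w _; rewrite lee_fin funrneg_ge0.
  apply: eq_esum => w _; rewrite -EFinD; congr EFin.
  by rewrite -[LHS]/((Num.norm \o f) w) -funrposDneg.
rewrite /rsum -/p -/n.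
apply: (@le_trans _ _ (fine p + fine n)%:E).
  rewrite lee_fin (le_trans (ler_normB _ _))//.
  by rewrite !ger0_norm ?fine_ge0.
by clearbody p n; case: p p0 => [p| |]; case: n n0 => [n| |] // _ _; rewrite leey.
Qed.

(* [Q i j] is the entry in row [i] and column [j] *)
Definition column_stochastic {R : realType} {Omega : choiceType}
    (Q : Omega -> Omega -> R) : Prop :=
  (forall i j, 0 <= Q i j <= 1) /\
  (forall j, \esum_(i in [set: Omega]) (Q i j)%:E = 1%E).

Section Stochastic_operator.
Context {R : realType} {Omega : choiceType} {Q : Omega -> Omega -> R}.
Hypothesis sQ : column_stochastic Q.

Lemma stochastic_ell1 (X : ell1 R Omega) :
  (fun i => rsum (fun j => Q i j * X j)) \in ell1_pred.
Proof.
case: sQ => Q01 Q1.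
have Q0 i j : 0 <= Q i j by case/andP: (Q01 i j).
rewrite ell1_predE.
apply: (@le_lt_trans _ _ (\esum_(i in [set: Omega])
    \esum_(j in [set: Omega]) (`|Q i j * X j|)%:E)%E).
  by apply: le_esum => i _; exact: le_norm_rsum.
rewrite exchange_esumT; last by move=> i j; rewrite lee_fin.
have -> : (\esum_(j in [set: Omega]) \esum_(i in [set: Omega]) `|Q i j * X j|%:E
          = \esum_(j in [set: Omega]) `|X j|%:E)%E; last exact: ell1_prop.
apply: eq_esum => j _; rewrite -[RHS]mule1 -(Q1 j) -ge0_esumZl//; last first.
  by move=> i; rewrite lee_fin.
by apply: eq_esum => i _; rewrite normrM ger0_norm// mulrC EFinM.
Qed.

Definition stochastic_op (X : ell1 R Omega) : ell1 R Omega :=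
  Ell1 (stochastic_ell1 X).

End Stochastic_operator.

Section Mean_ergodic.
Context {R : numFieldType} {V : normedModType R}.
Variable T : V -> V.

Definition cesaro_mean (M : nat) (X : V) : V :=
  M%:R^-1 *: \sum_(0 <= i < M) iter i T X.

Definition mean_ergodic : set V := [set X | cvgn (fun M => cesaro_mean M X)].

Definition id_minus (X : V) : V := X - T X.

Definition kernel_id_minus : set V := id_minus @^-1` [set 0].

Definition image_id_minus : set V := range id_minus.

End Mean_ergodic.

(* Internal direct sum: every element of [S] is uniquely a sum of an element
   of [A] and an element of [B], and all such sums lie in [S] *)
Definition is_direct_sum {V : zmodType} (S A B : set V) : Prop :=
  set_bij (A `*` B) S (fun p => p.1 + p.2).

(* Main.v *)
Require Import Defs.
From HB Require Import structures.
From mathcomp Require Import all_boot all_order all_algebra.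
From mathcomp Require Import all_classical all_reals all_analysis.
Import Order.TTheory GRing.Theory Num.Theory numFieldNormedType.Exports.

Local Open Scope classical_set_scope.
Local Open Scope ring_scope.

(** The operator [Q] is a linear contraction of l^1, and the decomposition holds
for every linear contraction [T] of a normed space. The Cesaro means fix
[ker(Id - T)] pointwise, and they tend to [0] on [image(Id - T)] by
telescoping, hence on its closure since they are contractions; so
[C_M (X + Y) --> X] for [X] in the kernel and [Y] in the closure, which gives
one inclusion and uniqueness. Conversely, if [C_M X --> P] then [T P = P]
because [T C_M X - C_M X = (T^M X - X) / M --> 0], and [X - P] is the limit
of [X - C_M X], which lies in [image(Id - T)]. *)

Lemma scaler_invnK (R : numFieldType) (V : lmodType R) (n : nat) (v : V) :
  (0 < n)%N -> n%:R^-1 *: (v *+ n) = v.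
Proof.
by move=> n0; rewrite -(scaler_nat n v) scalerA mulVf ?scale1r// pnatr_eq0 -lt0n.
Qed.

(** * Cesaro means of a linear contraction *)

Section Linear_contraction.
Context {R : realType} {V : normedModType R} (T : {linear V -> V}).
Hypothesis T_contraction : forall X, `|T X| <= `|X|.
Implicit Types X Y : V.

Lemma iter_linearB n X Y : iter n T (X - Y) = iter n T X - iter n T Y.
Proof. by elim: n => //= n ->; rewrite linearB. Qed.

Lemma norm_iter_le n X : `|iter n T X| <= `|X|.
Proof. by elim: n => //= n; apply: le_trans; exact: T_contraction. Qed.

Lemma cesaro_meanB M X Y :
  cesaro_mean T M (X - Y) = cesaro_mean T M X - cesaro_mean T M Y.
Proof.
rewrite /cesaro_mean -scalerBr -sumrB; congr (_ *: _).
by apply: eq_bigr => i _; rewrite iter_linearB.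
Qed.

Lemma cesaro_meanD M X Y :
  cesaro_mean T M (X + Y) = cesaro_mean T M X + cesaro_mean T M Y.
Proof. by rewrite -{2}(addrK Y X) cesaro_meanB subrK. Qed.

Lemma norm_cesaro_mean_le M X : `|cesaro_mean T M X| <= `|X|.
Proof.
(* At [M = 0] the inverse of 0 is 0 by convention, so the mean is 0; dividing by [M] below requires
   [0 < M]. *)
have [->|M0] := posnP M.
  by rewrite /cesaro_mean invr0 scale0r normr0.
rewrite /cesaro_mean normrZ ger0_norm ?invr_ge0// ler_pdivrMl ?ltr0n//.
rewrite (le_trans (ler_norm_sum _ _ _))//.
rewrite (le_trans (ler_sum _ (fun i _ => norm_iter_le i X)))//.
by rewrite sumr_const_nat subn0 mulr_natl.
Qed.

Lemma cesaro_mean_fixed M X :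
  (0 < M)%N -> kernel_id_minus T X -> cesaro_mean T M X = X.
Proof.
move=> M0 /eqP; rewrite subr_eq0 => /eqP TX.
have itX i : iter i T X = X by elim: i => //= i ->.
rewrite /cesaro_mean (eq_bigr (fun=> X)) => [|i _]; last exact: itX.
by rewrite sumr_const_nat subn0 scaler_invnK.
Qed.

Lemma cesaro_mean_id_minus M X :
  cesaro_mean T M (id_minus T X) = M%:R^-1 *: (X - iter M T X).
Proof.
have /= tX := telescope_sumr (fun i => iter i T X) (leq0n M).
rewrite /cesaro_mean -[X - _]opprB -tX -sumrN.
congr (_ *: _); apply: eq_bigr => i _.
by rewrite /id_minus iter_linearB opprB -iterSr.
Qed.

Lemma id_minus_cesaro_mean M X :
  id_minus T (cesaro_mean T M X) = cesaro_mean T M (id_minus T X).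
Proof.
rewrite /id_minus cesaro_meanB; congr (_ - _).
rewrite /cesaro_mean linearZ linear_sum; congr (_ *: _).
by apply: eq_bigr => i _; rewrite -iterSr.
Qed.

Lemma norm_cesaro_mean_id_minus M X :
  `|cesaro_mean T M (id_minus T X)| <= M%:R^-1 * (2 * `|X|).
Proof.
rewrite cesaro_mean_id_minus normrZ ger0_norm ?invr_ge0// ler_wpM2l ?invr_ge0//.
by rewrite (le_trans (ler_normB _ _))// mulr2n mulrDl mul1r lerD2l norm_iter_le.
Qed.

Lemma cvg_cesaro_mean_id_minus X :
  cesaro_mean T M (id_minus T X) @[M --> \oo] --> (0 : V).
Proof.
apply: norm_cvg0; apply: (@squeeze_cvgr _ _ _ _ (fun=> 0)
    (fun M : nat => M%:R^-1 * (2 * `|X|))); last 2 first.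
- exact: cvg_cst.
- rewrite -(mul0r (2 * `|X|)); apply: cvgMr_tmp.
  (* The harmonic sequence is 1/(n+1), hence the shift by one. *)
  rewrite -(cvg_shiftn 1)/=; under eq_fun do rewrite addn1.
  exact: cvg_harmonic.
by near=> M; rewrite normr_ge0 norm_cesaro_mean_id_minus.
Unshelve. all: by end_near. Qed.

Lemma cvg_cesaro_mean_closure Y : closure (image_id_minus T) Y ->
  cesaro_mean T M Y @[M --> \oo] --> (0 : V).
Proof.
move=> clY; apply/cvgr0Pnorm_lt => e e0.
have e2 : 0 < e / 2 by rewrite divr_gt0.
have [_ [[W _ <-] YW]] := clY _ (nbhsx_ballx Y (e / 2) e2).
have /cvgr0Pnorm_lt/(_ _ e2) CW := cvg_cesaro_mean_id_minus W.
move: YW; rewrite -ball_normE /= => YW.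
(* Split [Y] into [Y - id_minus T W] and [id_minus T W]: the mean of the first has norm below
   [e / 2] for every [M], that of the second for large [M]. *)
near=> M; rewrite -(subrK (cesaro_mean T M (id_minus T W)) (cesaro_mean T M Y)).
rewrite -cesaro_meanB (splitr e) (le_lt_trans (ler_normD _ _))// ltrD//.
  exact: le_lt_trans (norm_cesaro_mean_le _ _) YW.
by near: M.
Unshelve. all: by end_near. Qed.

Lemma cvg_cesaro_meanD X Y :
    kernel_id_minus T X -> closure (image_id_minus T) Y ->
  cesaro_mean T M (X + Y) @[M --> \oo] --> X.
Proof.
move=> kX cY; under eq_fun do rewrite cesaro_meanD.
rewrite -[in nbhs X](addr0 X); apply: cvgD; last exact: cvg_cesaro_mean_closure.
apply: cvg_near_cst; near=> M; apply: cesaro_mean_fixed => //.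
by near: M; exact: nbhs_infty_gt.
Unshelve. all: by end_near. Qed.

(** A contraction is continuous, so [id_minus T (cesaro_mean T M X)] tends to [P - T P]; since
    [Id - T] commutes with the means, the same sequence tends to 0. *)
Lemma lim_cesaro_mean_fixed X P :
  cesaro_mean T M X @[M --> \oo] --> P -> kernel_id_minus T P.
Proof.
move=> CP; have TCP : T (cesaro_mean T M X) @[M --> \oo] --> T P.
  apply/cvgrPdist_lt => e e0; move/cvgrPdist_lt/(_ _ e0) : CP; apply: filterS => M.
  by rewrite -linearB; apply: le_lt_trans; exact: T_contraction.
have := cvg_cesaro_mean_id_minus X.
under eq_fun do rewrite -id_minus_cesaro_mean.
by apply: cvg_unique; [exact: norm_hausdorff|exact: cvgB].
Qed.

(** By telescoping, X - T^i X is the image under Id - T of the sum of T^k X over k < i; averaging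
    over i < M gives the witness. *)
Lemma image_sub_cesaro_mean M X : (0 < M)%N ->
  image_id_minus T (X - cesaro_mean T M X).
Proof.
move=> M0.
exists (M%:R^-1 *: \sum_(0 <= i < M) \sum_(0 <= k < i) iter k T X) => //.
rewrite /id_minus linearZ -scalerBr linear_sum -sumrB.
rewrite (eq_bigr (fun i => X - iter i T X)) => [|i _].
  rewrite sumrB scalerBr; congr (_ - _).
  by rewrite sumr_const_nat subn0 scaler_invnK.
have /= tX := telescope_sumr (fun i => iter i T X) (leq0n i).
rewrite linear_sum -[RHS]opprB -tX -[RHS]sumrN -sumrB.
by apply: eq_bigr => k _; rewrite opprB.
Qed.

Lemma mean_ergodic_direct_sum :
  is_direct_sum (mean_ergodic T) (kernel_id_minus T) (closure (image_id_minus T)).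
Proof.
split.
- move=> [X Y] /= [kX cY]; apply/cvg_ex; exists X; exact: cvg_cesaro_meanD.
- move=> [X Y] [X' Y'] /set_mem[/= kX cY] /set_mem[/= kX' cY'] /= XY.
  (* The kernel component is recovered from the sum as the limit of its Cesaro means. *)
  have XX' : X = X'.
    apply: (cvg_unique _ (cvg_cesaro_meanD _ _ kX cY)); first exact: norm_hausdorff.
    by rewrite XY; exact: cvg_cesaro_meanD.
  by move: XY; rewrite XX' => /addrI ->.
- move=> X /cvg_ex[P CP]; exists (P, X - P); last by rewrite /= addrC subrK.
  split => /=; first exact: lim_cesaro_mean_fixed CP.
  apply: (@closed_cvg _ _ \oo _ (fun M => X - cesaro_mean T M X)).
  + exact: closed_closure.
  + near=> M; apply: subset_closure; apply: image_sub_cesaro_mean.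
    by near: M; exact: nbhs_infty_gt.
  + by apply: cvgB => //; exact: cvg_cst.
Unshelve. all: by end_near. Qed.

End Linear_contraction.

(** * Linearity of unordered sums of summable real families *)

Section Rsum_linear.
Context {R : realType} {Omega : choiceType}.
Implicit Types f g p n : Omega -> R.

Local Notation sum f := (\esum_(w in [set: Omega]) (f w)%:E)%E.

Lemma ge0_esum_fin_num p : (forall w, 0 <= p w) -> p \in ell1_pred ->
  (sum p \is a fin_num)%E.
Proof.
move=> p0; rewrite ell1_predE ge0_fin_numE.
  by under eq_esum do rewrite ger0_norm//.
by apply: esum_ge0 => w _; rewrite lee_fin.
Qed.

Lemma ell1_pred_funrpos f : f \in ell1_pred -> f^\+ \in ell1_pred.
Proof. by move=> /summable_funepos; rewrite funerpos. Qed.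

Lemma ell1_pred_funrneg f : f \in ell1_pred -> f^\- \in ell1_pred.
Proof. by move=> /summable_funeneg; rewrite funerneg. Qed.

Lemma esum_funrpos_fin_num f : f \in ell1_pred -> sum f^\+ \is a fin_num.
Proof.
move=> sf; apply: ge0_esum_fin_num; first exact: funrpos_ge0.
exact: ell1_pred_funrpos.
Qed.

Lemma esum_funrneg_fin_num f : f \in ell1_pred -> sum f^\- \is a fin_num.
Proof.
move=> sf; apply: ge0_esum_fin_num; first exact: funrneg_ge0.
exact: ell1_pred_funrneg.
Qed.

(** Here [p] and [n] may overlap: any splitting into nonnegative summable families computes [rsum],
    not only the positive and negative parts. *)
Lemma rsumB p n : (forall w, 0 <= p w) -> (forall w, 0 <= n w) ->
    p \in ell1_pred -> n \in ell1_pred ->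
  rsum (p \- n) = fine (sum p) - fine (sum n).
Proof.
move=> p0 n0 sp sn.
have sB : (p \- n : Omega -> R) \in ell1_pred by exact: rpredB.
have := esumB sp sn (fun w _ => p0 w) (fun w _ => n0 w).
rewrite -[(_ \- _)%E]/(EFin \o (p \- n)) funerpos funerneg /=.
move=> /(congr1 fine).
rewrite !fineB//; first exact: ge0_esum_fin_num.
- exact: ge0_esum_fin_num.
- exact: esum_funrpos_fin_num.
- exact: esum_funrneg_fin_num.
Qed.

Lemma rsumN f : rsum (\- f) = - rsum f.
Proof. by rewrite /rsum opprB funrposN funrnegN. Qed.

Lemma rsumD f g : f \in ell1_pred -> g \in ell1_pred ->
  rsum (f \+ g) = rsum f + rsum g.
Proof.
move=> sf sg.
(* In general these are not the positive and negative parts of [f \+ g], which is why [rsumB] is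
   used. *)
have -> : f \+ g = (f^\+ \+ g^\+) \- (f^\- \+ g^\-) by rewrite -[LHS]funrDB.
have [sfp sfn] := (ell1_pred_funrpos _ sf, ell1_pred_funrneg _ sf).
have [sgp sgn] := (ell1_pred_funrpos _ sg, ell1_pred_funrneg _ sg).
rewrite rsumB; last 4 first.
- by move=> w; rewrite addr_ge0 ?funrpos_ge0.
- by move=> w; rewrite addr_ge0 ?funrneg_ge0.
- exact: rpredD.
- exact: rpredD.
under eq_esum do rewrite EFinD.
under [X in _ - fine X]eq_esum do rewrite EFinD.
rewrite !esumD => [|w _|w _|w _|w _]; rewrite ?lee_fin ?funrpos_ge0 ?funrneg_ge0//.
have [pf nf] := (esum_funrpos_fin_num _ sf, esum_funrneg_fin_num _ sf).
have [pg ng] := (esum_funrpos_fin_num _ sg, esum_funrneg_fin_num _ sg).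
rewrite !fineD//.
by rewrite /rsum opprD addrACA.
Qed.

Lemma rsumZ (a : R) f : f \in ell1_pred -> rsum (fun w => a * f w) = a * rsum f.
Proof.
move=> sf.
have [pf nf] := (esum_funrpos_fin_num _ sf, esum_funrneg_fin_num _ sf).
have pos b : 0 <= b -> rsum (fun w => b * f w) = b * rsum f.
  move=> b0; rewrite /rsum ge0_funrposM// ge0_funrnegM//.
  under eq_esum do rewrite EFinM.
  under [X in _ - fine X]eq_esum do rewrite EFinM.
  rewrite !ge0_esumZl// => [|w|w]; rewrite ?lee_fin ?funrpos_ge0 ?funrneg_ge0//.
  by rewrite !fineM//= mulrBr.
(* A negative factor exchanges the two parts; apply the nonnegative case to [- a] and negate the
   sum. *)
have [/pos//|/ltW] := leP 0 a; rewrite -oppr_ge0 => /pos.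
rewrite mulNr => /(congr1 -%R); rewrite opprK -rsumN => <-.
by congr rsum; apply/funext => w /=; rewrite mulNr opprK.
Qed.

Lemma rsum_linear (a : R) f g : f \in ell1_pred -> g \in ell1_pred ->
  rsum (fun w => a * f w + g w) = a * rsum f + rsum g.
Proof.
move=> sf sg; rewrite -rsumZ// -rsumD//.
exact: (rpredZ a).
Qed.

End Rsum_linear.

(** * The stochastic operator as a linear contraction *)

Section Stochastic_operator.
Context {R : realType} {Omega : choiceType} {Q : Omega -> Omega -> R}.
Hypothesis sQ : column_stochastic Q.
Implicit Types X : ell1 R Omega.

(** Entries of [Q] lie in [0,1], so [X] dominates the family; this summability is what additivity of
    [rsum] requires. *)
Lemma stochastic_row_ell1 i X : (fun j => Q i j * X j) \in ell1_pred.
Proof.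
case: sQ => Q01 _; rewrite ell1_predE; apply: le_lt_trans (ell1_prop X).
apply: le_esum => j _ /=; rewrite lee_fin normrM.
by case/andP: (Q01 i j) => Q0 Q1; rewrite ger0_norm// ler_piMl.
Qed.

Lemma stochastic_op_linear : linear (stochastic_op sQ).
Proof.
move=> a X Y; apply/val_inj/funext => i /=.
rewrite -[RHS]/(a * rsum _ + rsum _) -rsum_linear; last 2 first.
- exact: stochastic_row_ell1.
- exact: stochastic_row_ell1.
congr rsum; apply/funext => j.
rewrite -[LHS]/(Q i j * (a * X j + Y j)).
by rewrite mulrDr mulrCA.
Qed.

(** After the triangle inequality in each row, Tonelli exchanges the two sums, and each column of
    [Q] contributes total mass 1. *)
Lemma stochastic_op_contraction X : `|stochastic_op sQ X| <= `|X|.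
Proof.
have [Q01 Q1] := sQ.
have Q0 i j : 0 <= Q i j by case/andP: (Q01 i j).
rewrite -lee_fin !ell1_normE !ell1_normK.
apply: (@le_trans _ _ (\esum_(i in [set: Omega])
    \esum_(j in [set: Omega]) (`|Q i j * X j|)%:E)%E).
  by apply: le_esum => i _; exact: le_norm_rsum.
rewrite exchange_esumT//; apply: le_esum => j _.
rewrite -[leRHS]mule1 -(Q1 j) -ge0_esumZl// => [|i]; last by rewrite lee_fin.
by apply: le_esum => i _; rewrite normrM ger0_norm// mulrC EFinM.
Qed.

HB.instance Definition _ :=
  GRing.isLinear.Build R (ell1 R Omega) (ell1 R Omega) *:%R (stochastic_op sQ)
    stochastic_op_linear.

End Stochastic_operator.

Theorem theorem13 (R : realType) (Omega : choiceType)
    (hOmega : ([set: Omega] #= [set: nat])%card)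
    (Q : Omega -> Omega -> R) (sQ : column_stochastic Q) :
  is_direct_sum
    (mean_ergodic (stochastic_op sQ))
    (kernel_id_minus (stochastic_op sQ))
    (closure (image_id_minus (stochastic_op sQ))).
Proof. exact/mean_ergodic_direct_sum/stochastic_op_contraction. Qed.
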